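(* Let $f(\cdot,\xi)$ be $(H_0,H_1)$-smooth and convex for almost every $\xi\sim\mathcal D$, and let the stochastic gradient oracle be unbiased and satisfy the strong growth condition with constant $\rho\ge1$, i.e. $\mathbb{E}_\xi[\|\nabla f(x,\xi)\|^2]\le\rho\|\nabla f(x)\|^2$ for all $x\in\mathbb{R}^d$. Then NSGD with any $\lambda>0$, constant step size $$0<\eta\le\frac{\lambda}{H_0+\max\{\sqrt{H_1},H_1R_0\}\,\lambda}$$ and batch size $B\ge64(\rho-1)$ guarantees, after $N$ iterations, $$\mathbb{E}[f(x^N)]-f^*\le\left(1-\frac{\eta}{4R_0}\right)^NF_0+6\lambda R_0,$$ where $R_0=\|x^0-x^*\|$ and $F_0=f(x^0)-f^*$.
   Context: Setting: $f(x)=\mathbb{E}_{\xi\sim\mathcal D}[f(x,\xi)]$ on $\mathbb{R}^d$, with $f$ and $f(\cdot,\xi)$ differentiable, $f^*=\min_{x}f(x)$, $x^*\in\arg\min f$, and $\|\cdot\|$ the Euclidean norm. The oracle returns stochastic gradients $\nabla f(x,\xi)$, $\xi\sim\mathcal D$. ''$f(\cdot,\xi)$ is $(H_0,H_1)$-smooth'' means: for all $x,y\in\mathbb{R}^d$ with $\|y-x\|\le1/\sqrt{H_1}$, $$\|\nabla f(y,\xi)-\nabla f(x,\xi)\|\le\big(H_0+H_1[f(x,\xi)-f_\xi^*]\big)\|y-x\|,\qquad f_\xi^*:=\inf_{x\in\mathbb{R}^d}f(x,\xi).$$ Convexity of $f(\cdot,\xi)$: $f(y,\xi)\ge f(x,\xi)+\langle\nabla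 f(x,\xi),y-x\rangle$ for all $x,y$. Unbiasedness: $\mathbb{E}_\xi[\nabla f(x,\xi)]=\nabla f(x)$ for all $x$. NSGD: given $x^0\in\mathbb{R}^d$, integer batch size $B\ge1$, $\eta>0$, $\lambda>0$; at iteration $k$ draw fresh i.i.d. samples $\xi_1^k,\dots,\xi_B^k\sim\mathcal D$ (independent of the past), form $g^k=\frac1B\sum_{i=1}^B\nabla f(x^k,\xi_i^k)$, and set $x^{k+1}=x^k-\eta\,\frac{g^k}{\|g^k\|+\lambda}$.
   Formalization: The factor 1−η/(4R_0) is replaced by its positive part max{0, 1−η/(4R_0)}: for η>4R_0 the literal bound fails (f=x²/2, H_0=1, H_1=0, ρ=B=λ=η=1, x^0=0.01, N=3 makes the right side negative). *)

(* Defs.v *)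
From HB Require Import structures.
From mathcomp Require Import all_boot all_order all_algebra finmap.
From mathcomp Require Import all_classical all_reals all_analysis.

Set Implicit Arguments.
Unset Strict Implicit.
Unset Printing Implicit Defensive.

Import Order.TTheory GRing.Theory Num.Theory.
Import numFieldNormedType.Exports.

Local Open Scope classical_set_scope.
Local Open Scope ring_scope.

Definition dotp (R : realType) (d : nat) (u v : 'rV[R]_d) : R :=
  \sum_(i < d) u 0 i * v 0 i.

(* The library norm `|u| on 'rV[R]_d is the sup norm, hence this definition;
   both norms induce the same topology, so that the library notion of
   differentiability on 'rV[R]_d is the usual one. *)
Definition norm2 (R : realType) (d : nat) (u : 'rV[R]_d) : R :=
  Num.sqrt (dotp u u).

Definition grad (R : realType) (d : nat) (h : 'rV[R]_d -> R) (x : 'rV[R]_d) :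
    'rV[R]_d :=
  \row_(i < d) 'D_(delta_mx 0 i) h x.

(* inf h is taken in the extended reals, where it is -oo when h is not bounded
   below; and 1 / sqrt H1 is read as +oo when H1 = 0. *)
Definition H0H1_smooth (R : realType) (d : nat) (H0 H1 : R)
    (h : 'rV[R]_d -> R) : Prop :=
  forall x y : 'rV[R]_d, (0 < H1 -> norm2 (y - x) <= 1 / Num.sqrt H1) ->
    ((norm2 (grad h y - grad h x))%:E <=
     (H0%:E + H1%:E * ((h x)%:E - ereal_inf (range (EFin \o h)))) *
       (norm2 (y - x))%:E)%E.

Definition grad_convex (R : realType) (d : nat) (h : 'rV[R]_d -> R) : Prop :=
  forall x y : 'rV[R]_d, h x + dotp (grad h x) (y - x) <= h y.

(* The vector-valued expectation is taken coordinatewise. *)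
Definition unbiased (R : realType) (d : nat) (dT : measure_display)
    (T : measurableType dT) (D : probability T R)
    (f : T -> 'rV[R]_d -> R) (F : 'rV[R]_d -> R) : Prop :=
  forall (x : 'rV[R]_d) (i : 'I_d),
    ('E_D[fun t => (grad (f t) x 0 i)%R] = (grad F x 0 i)%:E)%E.

Definition strong_growth (R : realType) (d : nat) (dT : measure_display)
    (T : measurableType dT) (D : probability T R)
    (f : T -> 'rV[R]_d -> R) (F : 'rV[R]_d -> R) (rho : R) : Prop :=
  forall x : 'rV[R]_d,
    ('E_D[fun t => (norm2 (grad (f t) x) ^+ 2)%R] <=
     (rho * norm2 (grad F x) ^+ 2)%:E)%E.

Definition mutually_independent (R : realType) (dO dT : measure_display)
    (Omega : measurableType dO) (T : measurableType dT)
    (P : probability Omega R) (I : choiceType) (X : I -> {RV P >-> T}) : Prop :=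
  forall (J : {fset I}) (A : I -> set T), (forall j, measurable (A j)) ->
    P (\bigcap_(j in [set` J]) (X j @^-1` A j)) =
    (\prod_(j <- J) P (X j @^-1` A j))%E.

(* The samples xi k i (i < B) are those drawn at iteration k. As the iterate
   of index k depends on the samples of index < k only, the independence of the
   whole family makes the samples of iteration k independent of the past. *)
Definition iid_samples (R : realType) (dO dT : measure_display)
    (Omega : measurableType dO) (T : measurableType dT)
    (P : probability Omega R) (D : probability T R) (B : nat)
    (xi : nat -> 'I_B -> {RV P >-> T}) : Prop :=
  (forall k i A, measurable A -> distribution P (xi k i) A = D A) /\
  mutually_independent (fun ki : nat * 'I_B => xi ki.1 ki.2).

Definition batch_grad (R : realType) (d B : nat) (T : Type)
    (f : T -> 'rV[R]_d -> R) (x : 'rV[R]_d) (s : 'I_B -> T) : 'rV[R]_d :=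
  B%:R^-1 *: \sum_(i < B) grad (f (s i)) x.

Fixpoint nsgd (R : realType) (d B : nat) (T : Type)
    (f : T -> 'rV[R]_d -> R) (eta lambda : R) (x0 : 'rV[R]_d)
    (s : nat -> 'I_B -> T) (k : nat) : 'rV[R]_d :=
  if k is k'.+1 then
    let x := nsgd f eta lambda x0 s k' in
    let g := batch_grad f x (s k') in
    x - (eta / (norm2 g + lambda)) *: g
  else x0.

(* Main.v *)
Require Import Defs.
From HB Require Import structures.
From mathcomp Require Import all_boot all_order all_algebra finmap.
From mathcomp Require Import all_classical all_reals all_analysis.
From mathcomp Require Import measurable_realfun.
From mathcomp Require Import ring lra.

Set Implicit Arguments.
Unset Strict Implicit.
Unset Printing Implicit Defensive.

Import Order.TTheory GRing.Theory Num.Theory.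
Import numFieldNormedType.Exports.

Local Open Scope classical_set_scope.
Local Open Scope ring_scope.

(** The strong growth condition forces almost every sample gradient to vanish
    at the minimiser [xs] of [F], so that, by convexity, [xs] minimises almost
    every [f t]. Consequently [h = f t], with [g = grad h], satisfies

      h x + <g x, y - x> <= h y,
      h y <= h x + <g x, y - x> + (H0 + H1 (h x - h xs)) / 2 |y - x|^2

    as soon as [H1 |y - x|^2 <= 1], and [h xs <= h y] for all [y]. This is
    [smooth_convex_model]. As these inequalities are linear in the pair [(h, g)],
    they pass to the average over a batch ([smooth_convex_model_avg]) and to the
    expectation [F] ([population_model]).

    The bound on the step size implies [eta H0 <= lambda],
    [eta H1 R0 <= 1] and [H1 eta^2 <= 1]. Applied to the batch average, the
    model shows that a step never moves the iterate away from [xs]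
    ([model_step_dist]), so that the iterates remain in the ball of radius [R0].
    Applied to [F], it gives with [G = |grad F x|] and [e] the error of the
    batch gradient the pathwise inequality [model_noisy_step]:

      F(x+) - F xs + (eta / 2) G
        <= F x - F xs + 2 eta |e| + (3 / 2) eta lambda.

    The samples of a batch being independent, the mean of [|e|^2] conditionally
    on the current iterate is at most [(rho - 1) / B * G^2]; since
    [64 (rho - 1) <= B] this yields [E |e| <= E G / 8] ([noise_mean]). With
    [F x - F xs <= G R0] the expected gap [a_k] satisfies

      a_(k+1) <= (1 - eta / (4 R0)) a_k + (3 / 2) eta lambda,

    whose fixed point is [6 lambda R0]. When [eta > 4 R0] the contraction factor
    would be negative, but then the second inequality of the model, taken at
    [xs], bounds the gap by [lambda R0] at every iterate.

    The conditional expectations are replaced by Tonelli's theorem: the law of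
    the pair (past, new sample) is a product measure, where the past is [Omega]
    with the sigma-algebra generated by the earlier samples ([freezing]). Measurability
    of a random vector is that of its coordinates, and a function continuous in
    the vector and measurable in the sample is jointly measurable
    ([measurable_caratheodory]); gradients are limits of such functions. *)

(** * Euclidean geometry of row vectors *)

Section euclidean.
Context (R : realType) (d : nat).
Implicit Types (u v w : 'rV[R]_d) (c : R).

Lemma dotpC u v : dotp u v = dotp v u.
Proof. by apply: eq_bigr => i _; rewrite mulrC. Qed.

Lemma dotpDl u v w : dotp (u + v) w = dotp u w + dotp v w.
Proof. by rewrite -big_split; apply: eq_bigr => i _; rewrite mxE mulrDl. Qed.

Lemma dotpZl c u w : dotp (c *: u) w = c * dotp u w.
Proof. by rewrite /dotp mulr_sumr; apply: eq_bigr => i _; rewrite mxE mulrA. Qed.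

Lemma dotpNl u w : dotp (- u) w = - dotp u w.
Proof. by rewrite -scaleN1r dotpZl mulN1r. Qed.

Lemma dotpBl u v w : dotp (u - v) w = dotp u w - dotp v w.
Proof. by rewrite dotpDl dotpNl. Qed.

Lemma dotp0l w : dotp 0 w = 0.
Proof. by rewrite -(scale0r 0) dotpZl mul0r. Qed.

Lemma dotpDr w u v : dotp w (u + v) = dotp w u + dotp w v.
Proof. by rewrite dotpC dotpDl !(dotpC _ w). Qed.

Lemma dotpZr c w u : dotp w (c *: u) = c * dotp w u.
Proof. by rewrite dotpC dotpZl (dotpC _ w). Qed.

Lemma dotpNr w u : dotp w (- u) = - dotp w u.
Proof. by rewrite dotpC dotpNl (dotpC _ w). Qed.

Lemma dotpBr w u v : dotp w (u - v) = dotp w u - dotp w v.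
Proof. by rewrite dotpDr dotpNr. Qed.

Lemma dotp_suml (I : Type) (r : seq I) (u_ : I -> 'rV[R]_d) w :
  dotp (\sum_(i <- r) u_ i) w = \sum_(i <- r) dotp (u_ i) w.
Proof.
elim: r => [|i r IHr]; first by rewrite !big_nil dotp0l.
by rewrite !big_cons dotpDl IHr.
Qed.

Lemma dotpvv_ge0 u : 0 <= dotp u u.
Proof. by apply: sumr_ge0 => i _; rewrite -expr2 sqr_ge0. Qed.

Lemma norm2_ge0 u : 0 <= norm2 u.
Proof. exact: sqrtr_ge0. Qed.

Lemma norm2_sqr u : norm2 u ^+ 2 = dotp u u.
Proof. by rewrite sqr_sqrtr ?dotpvv_ge0. Qed.

Lemma norm2Z c u : norm2 (c *: u) = `|c| * norm2 u.
Proof.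
by rewrite /norm2 dotpZl dotpZr mulrA -expr2 sqrtrM ?sqr_ge0// sqrtr_sqr.
Qed.

Lemma norm2N u : norm2 (- u) = norm2 u.
Proof. by rewrite -scaleN1r norm2Z normrN1 mul1r. Qed.

Lemma norm2B u v : norm2 (u - v) = norm2 (v - u).
Proof. by rewrite -norm2N opprB. Qed.

Lemma norm2D_sqr u v :
  norm2 (u + v) ^+ 2 = norm2 u ^+ 2 + 2 * dotp u v + norm2 v ^+ 2.
Proof. by rewrite !norm2_sqr !(dotpDl, dotpDr) (dotpC v u); ring. Qed.

Lemma norm2B_sqr u v :
  norm2 (u - v) ^+ 2 = norm2 u ^+ 2 - 2 * dotp u v + norm2 v ^+ 2.
Proof. by rewrite norm2D_sqr dotpNr norm2N mulrN. Qed.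

Lemma norm2_eq0P u : norm2 u = 0 -> u = 0.
Proof.
move=> u0; have : dotp u u == 0 by rewrite -norm2_sqr u0 expr0n.
rewrite psumr_eq0 => [/allP uu0|i _]; last by rewrite -expr2 sqr_ge0.
apply/rowP => i; rewrite mxE; apply/eqP.
by have := uu0 i (mem_index_enum i); rewrite /= mulf_eq0 orbb.
Qed.

Lemma coord_le_norm2 u i : `|u 0 i| <= norm2 u.
Proof.
rewrite -sqrtr_sqr ler_wsqrtr// /dotp (bigD1 i)//= -expr2 lerDl.
by apply: sumr_ge0 => j _; rewrite -expr2 sqr_ge0.
Qed.

Lemma dotp_le_norm2 u v : dotp u v <= norm2 u * norm2 v.
Proof.
have [u0|un0] := eqVneq (norm2 u) 0.
  by rewrite (norm2_eq0P u0) dotp0l mulr_ge0 ?norm2_ge0.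
have [v0|vn0] := eqVneq (norm2 v) 0.
  by rewrite (norm2_eq0P v0) dotpC dotp0l mulr_ge0 ?norm2_ge0.
have u_gt0 : 0 < norm2 u by rewrite lt0r un0 norm2_ge0.
have v_gt0 : 0 < norm2 v by rewrite lt0r vn0 norm2_ge0.
have := dotpvv_ge0 (norm2 v *: u - norm2 u *: v).
rewrite -norm2_sqr norm2B_sqr !norm2Z !ger0_norm ?norm2_ge0// dotpZl dotpZr.
set a := norm2 u; set b := norm2 v; set e := dotp u v => H.
have : 0 <= (2 * a * b) * (a * b - e) by apply: le_trans H _; lra.
by rewrite pmulr_rge0 ?subr_ge0// !mulr_gt0.
Qed.

Lemma norm2D_le u v : norm2 (u + v) <= norm2 u + norm2 v.
Proof.
rewrite -(ler_pXn2r (n := 2))// ?nnegrE ?addr_ge0 ?norm2_ge0//.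
by rewrite norm2D_sqr; have := dotp_le_norm2 u v; lra.
Qed.

End euclidean.

(** * Convex functions with a generalized smoothness bound *)

Section descent.
Context (R : realType) (d : nat).

Section telescope.
Variables (h : 'rV[R]_d -> R) (g : 'rV[R]_d -> 'rV[R]_d).
Hypothesis h_convex : forall x y, h x + dotp (g x) (y - x) <= h y.

(** The segment from [x] in direction [v] is cut into steps of length [t]. On
    each step the convexity inequality is used at the end point, and replacing
    the gradient there by [g x] costs [L] times the distance already covered,
    which adds up to the triangular number. This proves the descent inequality
    without any integral along the segment. *)
Lemma descent_subdivision (x v : 'rV[R]_d) (L t : R) (j : nat) : 0 <= t ->
  (forall s : R, 0 <= s <= j%:R * t ->
     norm2 (g (x + s *: v) - g x) <= L * (s * norm2 v)) ->
  h (x + (j%:R * t) *: v) <= h x + (j%:R * t) * dotp (g x) v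
     + L * norm2 v ^+ 2 * t ^+ 2 * (j%:R * (j%:R + 1) / 2).
Proof.
move=> t0; elim: j => [|j IHj] gL; first by rewrite !mul0r scale0r addr0 mulr0 !addr0.
have {}IHj := IHj _.
set y := x + (j.+1%:R * t) *: v; set z := x + (j%:R * t) *: v.
have hz : h z <= h x + (j%:R * t) * dotp (g x) v
     + L * norm2 v ^+ 2 * t ^+ 2 * (j%:R * (j%:R + 1) / 2).
  apply: IHj => s /andP[s0 sj]; apply: gL; rewrite s0/= (le_trans sj)//.
  by rewrite ler_wpM2r// ler_nat.
have zy : z - y = - t *: v.
  by rewrite /z /y opprD addrACA subrr add0r -scalerBl -natr1; congr (_ *: _); ring.
have := h_convex y z; rewrite zy dotpZr.
have := gL (j.+1%:R * t); rewrite lexx mulr_ge0 ?ler0n//= -/y => /(_ isT) gy.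
have := dotp_le_norm2 (g y - g x) v; rewrite dotpBl => cs.
have {cs} : dotp (g y) v - dotp (g x) v <= L * norm2 v ^+ 2 * (j.+1%:R * t).
  apply: le_trans cs _.
  by apply: le_trans (ler_wpM2r (norm2_ge0 v) gy) _; lra.
move=> /(ler_wpM2l t0); move: hz; rewrite -[j.+1%:R]natr1.
set J : R := j%:R; set a := dotp (g x) v; set b := dotp (g y) v.
set n := norm2 v => ? ? ?.
have -> : L * n ^+ 2 * t ^+ 2 * ((J + 1) * (J + 1 + 1) / 2) =
  L * n ^+ 2 * t ^+ 2 * (J * (J + 1) / 2) + t * (L * n ^+ 2 * ((J + 1) * t)).
  by field.
lra.
Qed.

Lemma descent_of_lipschitz (x y : 'rV[R]_d) (L : R) : 0 <= L ->
  (forall s : R, 0 <= s <= 1 ->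
     norm2 (g (x + s *: (y - x)) - g x) <= L * (s * norm2 (y - x))) ->
  h y <= h x + dotp (g x) (y - x) + L / 2 * norm2 (y - x) ^+ 2.
Proof.
move=> L0 gL; apply/ler_addgt0Pr => e e0.
set K := L * norm2 (y - x) ^+ 2 / 2.
have K0 : 0 <= K by rewrite divr_ge0// mulr_ge0// sqr_ge0.
(* The subdivision into [n] steps loses [K / n]; [n] makes it at most [e]. *)
pose m := Num.truncn (K / e); pose n : R := m.+1%:R.
have n0 : 0 < n by rewrite ltr0n.
have nK : K / n <= e.
  by rewrite ler_pdivrMr// mulrC -ler_pdivrMr// ltW// /n truncnS_gt.
have nt : m.+1%:R * n^-1 = 1 by rewrite mulfV// gt_eqF.
have := @descent_subdivision x (y - x) L n^-1 m.+1.
rewrite nt scale1r mul1r [x + (y - x)]addrC subrK invr_ge0 => /(_ (ltW n0) gL) /le_trans.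
apply; rewrite -!addrA lerD2l lerD2l -/n.
have -> : L * norm2 (y - x) ^+ 2 * n^-1 ^+ 2 * (n * (n + 1) / 2) = K + K / n.
  by rewrite /K; field; rewrite gt_eqF.
by rewrite lerD// /K; lra.
Qed.

End telescope.

(** The convex lower bound and the quadratic upper bound are required of an
    arbitrary field [g] in place of the gradient of [h], because averages of
    gradients are then covered without differentiating the averaged function. *)
Definition smooth_convex_model (H0 H1 : R) (xs : 'rV[R]_d)
    (h : 'rV[R]_d -> R) (g : 'rV[R]_d -> 'rV[R]_d) : Prop :=
  [/\ forall x y, h x + dotp (g x) (y - x) <= h y,
      forall x y, H1 * norm2 (y - x) ^+ 2 <= 1 ->
        h y <= h x + dotp (g x) (y - x)
               + (H0 + H1 * (h x - h xs)) / 2 * norm2 (y - x) ^+ 2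
    & forall y, h xs <= h y].

(** A vanishing gradient at [xs] makes [xs] a minimiser by convexity, so that the
    infimum in the smoothness condition is [h xs]. *)
Lemma smooth_convex_model_grad (H0 H1 : R) (xs : 'rV[R]_d) (h : 'rV[R]_d -> R) :
  0 <= H0 -> 0 <= H1 -> H0H1_smooth H0 H1 h -> grad_convex h ->
  grad h xs = 0 -> smooth_convex_model H0 H1 xs h (grad h).
Proof.
move=> H0_ge0 H1_ge0 h_smooth h_convex gxs.
have xs_min y : h xs <= h y by have := h_convex xs y; rewrite gxs dotp0l addr0.
have inf_h : ereal_inf (range (EFin \o h)) = (h xs)%:E.
  apply/eqP; rewrite eq_le; apply/andP; split.
    by apply: ereal_inf_lbound; exists xs.
  by apply: le_ereal_inf_tmp => _ [y _ <-]; rewrite lee_fin.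
split => // x y yx; apply: (descent_of_lipschitz h_convex).
  by rewrite addr_ge0// mulr_ge0// subr_ge0.
move=> s /andP[s0 s1].
have := h_smooth x (x + s *: (y - x)).
rewrite inf_h addrAC subrr add0r norm2Z ger0_norm// -EFinB -EFinM.
rewrite lee_fin; apply => H1_gt0.
apply: (@le_trans _ _ (norm2 (y - x))).
  by rewrite ler_piMl// norm2_ge0.
rewrite ler_pdivlMr ?sqrtr_gt0// -(ler_pXn2r (n := 2))// ?nnegrE//.
  by rewrite exprMn (sqr_sqrtr H1_ge0) expr1n mulrC.
by rewrite mulr_ge0 ?norm2_ge0 ?sqrtr_ge0.
Qed.

Lemma smooth_convex_model_avg (H0 H1 : R) (xs : 'rV[R]_d) (B : nat)
    (h : 'I_B -> 'rV[R]_d -> R) (g : 'I_B -> 'rV[R]_d -> 'rV[R]_d) :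
  (0 < B)%N -> (forall i, smooth_convex_model H0 H1 xs (h i) (g i)) ->
  smooth_convex_model H0 H1 xs (fun x => B%:R^-1 * \sum_(i < B) h i x)
    (fun x => B%:R^-1 *: \sum_(i < B) g i x).
Proof.
move=> B0 hg; have iB0 : 0 <= B%:R^-1 :> R by rewrite invr_ge0 ler0n.
have B1 : B%:R^-1 * B%:R = 1 :> R by rewrite mulVf// pnatr_eq0 -lt0n.
split => [x y|x y xy|y].
- rewrite dotpZl dotp_suml -mulrDr -big_split/= ler_wpM2l// ler_sum// => i _.
  by have [+ _ _] := hg i; apply.
- pose n := norm2 (y - x) ^+ 2; rewrite -/n.
  apply: (@le_trans _ _ (B%:R^-1 * \sum_(i < B) (h i x + dotp (g i x) (y - x)
      + (H0 + H1 * (h i x - h i xs)) / 2 * n))).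
    by rewrite ler_wpM2l// ler_sum// => i _; have [_ + _] := hg i; apply.
  rewrite !big_split/= -mulr_suml -mulr_suml big_split/= -mulr_sumr.
  rewrite big_split/= sumrN sumr_const card_ord dotpZl dotp_suml -[H0 *+ B]mulr_natr.
  set b : R := B%:R^-1; set S1 := \sum_(i < B) h i x; set S2 := \sum_(i < B) h i xs.
  set S3 := \sum_(i < B) _.
  have -> : b * (S1 + S3 + (H0 * B%:R + H1 * (S1 - S2)) / 2 * n) =
     b * S1 + b * S3 + ((b * B%:R) * H0 + H1 * (b * S1 - b * S2)) / 2 * n by ring.
  by rewrite B1 mul1r.
- by rewrite ler_wpM2l// ler_sum// => i _; have [_ _ +] := hg i; apply.
Qed.

End descent.

(** * One normalized gradient step *)

Section step.
Context (R : realType) (d : nat).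
Variables (H0 H1 R0 eta lambda : R) (xs : 'rV[R]_d).
Hypotheses (H0_ge0 : 0 <= H0) (H1_ge0 : 0 <= H1) (eta_gt0 : 0 < eta)
  (lambda_gt0 : 0 < lambda).
Hypotheses (eta_H0 : eta * H0 <= lambda) (eta_R0 : eta * H1 * R0 <= 1)
  (eta_H1 : H1 * eta ^+ 2 <= 1).

Lemma nsgd_step_small (g : 'rV[R]_d) :
  0 <= eta / (norm2 g + lambda) /\ eta / (norm2 g + lambda) * norm2 g <= eta.
Proof.
have := norm2_ge0 g => g0; have gl : 0 < norm2 g + lambda by rewrite ltr_wpDl.
split; first by rewrite divr_ge0// ltW.
by rewrite mulrAC ler_pdivrMr// ler_pM2l// lerDl ltW.
Qed.

Section model.
Variables (h : 'rV[R]_d -> R) (g : 'rV[R]_d -> 'rV[R]_d) (x : 'rV[R]_d).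
Hypotheses (hg : smooth_convex_model H0 H1 xs h g) (xR0 : norm2 (x - xs) <= R0).

Lemma model_gap_le : 0 <= h x - h xs <= norm2 (g x) * R0.
Proof.
have [cvx _ xs_min] := hg; rewrite subr_ge0 xs_min/=.
have := cvx x xs; have := dotp_le_norm2 (g x) (x - xs).
rewrite -[xs - x]opprB dotpNr => cs ?.
apply: (@le_trans _ _ (norm2 (g x) * norm2 (x - xs))); first by lra.
by rewrite ler_wpM2l// norm2_ge0.
Qed.

(** The gap is at most [R0] times the gradient norm, hence the local smoothness
    constant, multiplied by [eta], is absorbed by the normalization. *)
Lemma model_curvature_le :
  eta * (H0 + H1 * (h x - h xs)) <= lambda + norm2 (g x).
Proof.
have /andP[D0 D1] := model_gap_le.
have : eta * H1 * (h x - h xs) <= eta * H1 * (norm2 (g x) * R0).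
  by rewrite ler_wpM2l// mulr_ge0// ltW.
have : eta * H1 * R0 * norm2 (g x) <= 1 * norm2 (g x).
  by rewrite ler_wpM2r// norm2_ge0.
move: (eta_H0); lra.
Qed.

Lemma model_step_bound (u : 'rV[R]_d) (c : R) :
  c = eta / (norm2 u + lambda) ->
  h (x - c *: u) <= h x - c * dotp (g x) u
     + (H0 + H1 * (h x - h xs)) / 2 * (c * norm2 u) ^+ 2.
Proof.
move=> cE; have [c0 cu] := nsgd_step_small u; rewrite -cE in c0 cu.
have [_ desc _] := hg; have := desc x (x - c *: u).
rewrite addrAC subrr add0r dotpNr dotpZr norm2N norm2Z ger0_norm//; apply.
apply: le_trans eta_H1; rewrite ler_wpM2l// ler_pXn2r// ?nnegrE//; last exact: ltW.
by rewrite mulr_ge0// norm2_ge0.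
Qed.

(** The step from [x] along [g x] cannot decrease [h] below [h xs], while the
    quadratic term of the upper bound consumes at most half of the first-order
    decrease. *)
Lemma model_step_gap :
  eta / (norm2 (g x) + lambda) * norm2 (g x) ^+ 2 <= 2 * (h x - h xs).
Proof.
have [cvx _ xs_min] := hg.
set c := eta / _; have := @model_step_bound (g x) c erefl.
have := xs_min (x - c *: g x); rewrite -norm2_sqr.
have := model_curvature_le; set L := H0 + _; set G := norm2 (g x) => Lle.
have G0 : 0 <= G := norm2_ge0 _.
have [c0 _] := nsgd_step_small (g x); rewrite -/c in c0.
have cL : c * L <= 1.
  by rewrite /c mulrAC ler_pdivrMr ?mul1r 1?addrC// ltr_pwDl.
have : c * G ^+ 2 * (c * L) <= c * G ^+ 2 * 1.
  by rewrite ler_wpM2l// mulr_ge0// sqr_ge0.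
have -> : L / 2 * (c * G) ^+ 2 = c * G ^+ 2 * (c * L) / 2 by ring.
lra.
Qed.

(** Expanding the square, the cross term is at least twice the step size times
    the gap by convexity, which dominates the squared step by [model_step_gap]. *)
Lemma model_step_dist :
  norm2 (x - (eta / (norm2 (g x) + lambda)) *: g x - xs) <= norm2 (x - xs).
Proof.
have := model_step_gap; set c := eta / _ => gap.
have [c0 _] := nsgd_step_small (g x); rewrite -/c in c0.
rewrite -(ler_pXn2r (n := 2))// ?nnegrE ?norm2_ge0// addrAC norm2B_sqr.
rewrite dotpZr norm2Z ger0_norm//.
have [cvx _ _] := hg; have := cvx x xs.
rewrite -[xs - x]opprB dotpNr dotpC => Dle.
have : c * (c * norm2 (g x) ^+ 2) <= c * (2 * dotp (x - xs) (g x)).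
  by rewrite ler_wpM2l//; lra.
by lra.
Qed.

(** With [u = g x + e], Cauchy-Schwarz gives [<g x, u> >= |u|^2 - |e| |u|], and
    [|u|^2 / (|u| + lambda) >= |u| - lambda]; hence the first-order decrease is
    at least [eta (|g x| - 2 |e| - lambda)]. The step has length at most [eta],
    so that the quadratic term is at most [eta / 2 (lambda + |g x|)]. *)
Lemma model_noisy_step (u : 'rV[R]_d) :
  h (x - (eta / (norm2 u + lambda)) *: u) - h xs + eta / 2 * norm2 (g x) <=
  h x - h xs + 2 * eta * norm2 (u - g x) + 3 / 2 * eta * lambda.
Proof.
set c := eta / _; have := @model_step_bound u c erefl.
have [c0 cu] := nsgd_step_small u; rewrite -/c in c0 cu.
have := model_curvature_le; set L := H0 + _; set G := norm2 (g x) => Lle.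
have L0 : 0 <= L.
  by have /andP[? _] := model_gap_le; rewrite /L addr_ge0// mulr_ge0.
set e := norm2 (u - g x).
have u0 := norm2_ge0 u; have ul : 0 < norm2 u + lambda by rewrite ltr_wpDl.
have quad : L / 2 * (c * norm2 u) ^+ 2 <= eta / 2 * (lambda + G).
  apply: (@le_trans _ _ (L / 2 * eta ^+ 2)).
    rewrite ler_wpM2l ?divr_ge0// ler_pXn2r// ?nnegrE ?(ltW eta_gt0)//.
    by rewrite mulr_ge0.
  have -> : L / 2 * eta ^+ 2 = eta / 2 * (eta * L) by ring.
  by rewrite ler_wpM2l// divr_ge0// ltW.
have lin : eta * (G - 2 * e - lambda) <= c * dotp (g x) u.
  have Gle : G <= norm2 u + e.
    have := norm2D_le u (g x - u).
    by rewrite [u + (_ - u)]addrC subrK (norm2B (g x)) -/e -/G; lra.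
  have cs := dotp_le_norm2 (u - g x) u; rewrite dotpBl -norm2_sqr -/e in cs.
  rewrite /c mulrAC ler_pdivlMr// -mulrA ler_pM2l//.
  have e0 : 0 <= e := norm2_ge0 _.
  apply: (@le_trans _ _ (norm2 u ^+ 2 - e * norm2 u)); last by lra.
  apply: (@le_trans _ _ ((norm2 u - lambda - e) * (norm2 u + lambda))).
    by rewrite ler_pM2r//; lra.
  have : 0 <= lambda ^+ 2 := sqr_ge0 _.
  have : 0 <= e * lambda by rewrite mulr_ge0// ltW.
  by lra.
by lra.
Qed.

(** Consequence of [model_step_gap] and [G^2 / (G + lambda) >= G - lambda]. It
    transfers integrability from the gap to the gradient norm. *)
Lemma model_grad_le : norm2 (g x) <= 2 / eta * (h x - h xs) + lambda.
Proof.
have := model_step_gap; set G := norm2 (g x) => gap.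
have G0 : 0 <= G := norm2_ge0 _; have Gl : 0 < G + lambda by rewrite ltr_wpDl.
rewrite -lerBlDr -(ler_pM2l eta_gt0).
have -> : eta * (2 / eta * (h x - h xs)) = 2 * (h x - h xs).
  by field; rewrite gt_eqF.
apply: le_trans gap; rewrite mulrAC ler_pdivlMr// -mulrA ler_pM2l//.
have : 0 <= lambda ^+ 2 := sqr_ge0 _; lra.
Qed.

End model.
End step.

(** * Measurability of gradients *)

Section directional.
Context (R : realType) (d : nat).
Implicit Types (h : 'rV[R]_d -> R) (x v : 'rV[R]_d).

Lemma cvg_harmonic_dnbhs : (fun n => n.+1%:R^-1 : R) @ \oo --> (0 : R)^'.
Proof.
move=> A; rewrite /dnbhs /within /= => -[e /= e0 eA].
have /cvgrPdist_lt/(_ e e0) := @cvg_harmonic R; apply: filterS => n /= ne.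
by apply: eA => //; rewrite invr_neq0// pnatr_eq0.
Qed.

(** Directional derivatives as limits of sequences: this makes them measurable,
    and nonnegative at a minimiser. *)
Lemma derive_cvg_seq h x v : differentiable h x ->
  (fun n => n.+1%:R * (h (x + n.+1%:R^-1 *: v) - h x)) @ \oo --> 'D_v h x.
Proof.
move=> /(@diff_derivable _ _ _ h x v) hx.
have := cvg_comp _ _ cvg_harmonic_dnbhs hx.
apply: cvg_trans; apply: near_eq_cvg; near=> n => /=.
by rewrite invrK (addrC x).
Unshelve. all: by end_near. Qed.

(** All directional derivatives are nonnegative at a minimum, and they are odd in
    the direction. *)
Lemma grad_eq0_min h x : differentiable h x -> (forall y, h x <= h y) ->
  grad h x = 0.
Proof.
move=> hx xmin.
have D_ge0 v : 0 <= 'D_v h x.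
  apply: (cvgr_to_ge (@derive_cvg_seq h x v hx)).
  by apply: nearW => n; rewrite /= mulr_ge0// subr_ge0.
apply/rowP => i; rewrite !mxE; apply/eqP; rewrite eq_le D_ge0 andbT.
have := D_ge0 (- delta_mx 0 i); rewrite !deriveE// linearN oppr_ge0.
by apply.
Qed.

End directional.

Section measurability_in_coordinates.
Context (R : realType) (d : nat) (dU dV : measure_display)
  (U : measurableType dU) (V : measurableType dV).

Definition measurable_coord (dW : measure_display) (W : measurableType dW)
    (X : W -> 'rV[R]_d) : Prop :=
  forall i, measurable_fun setT (fun w => X w 0 i).

(* [node (grid x n) n] rounds [x] down to the lattice of mesh [1 / (n + 1)]. *)
Let grid (x : 'rV[R]_d) (n : nat) : 'rV[int]_d :=
  \row_i Num.floor (n.+1%:R * x 0 i).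
Let node (z : 'rV[int]_d) (n : nat) : 'rV[R]_d :=
  \row_i ((z 0 i)%:~R / n.+1%:R).

Lemma node_grid_cvg x : (fun n => node (grid x n) n) @ \oo --> x.
Proof.
apply/cvg_ballP => e e0; near=> n.
split => // i j; rewrite !mxE /ball/= /ball_/= (ord1 i).
have n0 : 0 < n.+1%:R :> R by rewrite ltr0n.
set a := n.+1%:R in n0 *; set y := x 0 j.
have : `|y - (Num.floor (a * y))%:~R / a| <= a^-1.
  have /andP[fl fu] := floor_itv (a * y); rewrite intrD1 in fu.
  have -> : y - (Num.floor (a * y))%:~R / a = (a * y - (Num.floor (a * y))%:~R) / a.
    by field; rewrite gt_eqF.
  rewrite normrM [X in _ * X]ger0_norm ?invr_ge0 ?(ltW n0)// ler_piMl//.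
    by rewrite invr_ge0 ltW.
  by rewrite ler_norml; lra.
move=> /le_lt_trans; apply; rewrite /a.
near: n; exact: (near_infty_natSinv_lt (PosNum e0)).
Unshelve. all: by end_near. Qed.

(** Rounding [X] to a lattice makes it countably valued, so that the composed
    function is measurable piece by piece; continuity in the vector argument
    gives the limit when the mesh tends to zero. *)
Lemma measurable_caratheodory (f : V -> 'rV[R]_d -> R) (X : U -> 'rV[R]_d) :
  (forall x, measurable_fun setT (f ^~ x)) -> (forall v, continuous (f v)) ->
  measurable_coord X -> measurable_fun setT (fun p : U * V => f p.2 (X p.1)).
Proof.
move=> mf cf mX.
apply: (@measurable_fun_cvg _ _ _ _
   (fun n (p : U * V) => f p.2 (node (grid (X p.1) n) n))); last first.
  move=> p _; have := cvg_comp _ _ (@node_grid_cvg (X p.1)) (@cf p.2 (X p.1)).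
  by apply: cvg_trans.
move=> n _ A mA; rewrite setTI.
have -> : (fun p : U * V => f p.2 (node (grid (X p.1) n) n)) @^-1` A =
    \bigcup_(z : 'rV[int]_d)
      ([set u | grid (X u) n = z] `*` (f ^~ (node z n) @^-1` A)).
  apply/seteqP; split => [[u v]/= fA|[u v]/= [z _ [/= <-]]//].
  by exists (grid (X u) n).
apply: countable_bigcupT_measurable => [|z]; first exact: countableP.
apply: measurableX; last by rewrite -[X in measurable X]setTI; exact: mf.
have -> : [set u | grid (X u) n = z] =
    \bigcap_(i in [set: 'I_d]) ((fun u => n.+1%:R * X u 0 i) @^-1`
      `[(z 0 i)%:~R, (z 0 i + 1)%:~R[%classic).
  apply/seteqP; split => [u /= <- i _|u /= uz].
    by rewrite /= in_itv/= mxE floor_itv.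
  apply/rowP => i; rewrite mxE; apply: floor_def.
  by have := uz i I; rewrite /= in_itv.
apply: fin_bigcap_measurable; first exact: finite_finset.
move=> i _; rewrite -[X in measurable X]setTI.
by apply: measurable_funM => //; exact: mX.
Qed.

Lemma measurable_coordD dW (W : measurableType dW) (X Y : W -> 'rV[R]_d) :
  measurable_coord X -> measurable_coord Y -> measurable_coord (fun w => X w + Y w).
Proof.
move=> mX mY i; rewrite (_ : (fun w => _) = (fun w => X w 0 i + Y w 0 i)).
  exact: measurable_funD.
by apply/funext => w; rewrite mxE.
Qed.

Lemma measurable_coordZ dW (W : measurableType dW) (c : W -> R) (X : W -> 'rV[R]_d) :
  measurable_fun setT c -> measurable_coord X -> measurable_coord (fun w => c w *: X w).
Proof.
move=> mc mX i; rewrite (_ : (fun w => _) = (fun w => c w * X w 0 i)).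
  exact: measurable_funM.
by apply/funext => w; rewrite mxE.
Qed.

Lemma measurable_coordB dW (W : measurableType dW) (X Y : W -> 'rV[R]_d) :
  measurable_coord X -> measurable_coord Y -> measurable_coord (fun w => X w - Y w).
Proof.
move=> mX mY; apply: measurable_coordD => // i.
rewrite (_ : (fun w => _) = (fun w => - Y w 0 i)); first exact: measurableT_comp.
by apply/funext => w; rewrite mxE.
Qed.

Lemma measurable_coord_cst dW (W : measurableType dW) (x : 'rV[R]_d) :
  measurable_coord (fun _ : W => x).
Proof. by move=> i; exact: measurable_cst. Qed.

Lemma measurable_coord_sum dW (W : measurableType dW) (I : Type) (r : seq I)
    (P : pred I) (X : I -> W -> 'rV[R]_d) :
  (forall i, measurable_coord (X i)) ->
  measurable_coord (fun w => \sum_(i <- r | P i) X i w).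
Proof.
move=> mX; elim: r => [|i r IHr].
  under [X in measurable_coord X]funext do rewrite big_nil.
  exact: measurable_coord_cst.
under [X in measurable_coord X]funext do rewrite big_cons.
by case: (P i) => //; exact: measurable_coordD.
Qed.

Lemma measurable_norm2 dW (W : measurableType dW) (X : W -> 'rV[R]_d) :
  measurable_coord X -> measurable_fun setT (fun w => norm2 (X w)).
Proof.
move=> mX; apply: (measurableT_comp (continuous_measurable_fun (@sqrt_continuous R))).
apply: measurable_sum => i; exact: measurable_funM.
Qed.

Lemma measurable_grad (f : V -> 'rV[R]_d -> R) (X : U -> 'rV[R]_d) :
  (forall x, measurable_fun setT (f ^~ x)) -> (forall v x, differentiable (f v) x) ->
  measurable_coord X ->
  measurable_coord (fun p : U * V => grad (f p.2) (X p.1)).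
Proof.
move=> mf df mX i; have cf v : continuous (f v).
  by move=> x; exact: differentiable_continuous.
apply: (@measurable_fun_cvg _ _ _ _ (fun n (p : U * V) => n.+1%:R *
  (f p.2 (X p.1 + n.+1%:R^-1 *: delta_mx 0 i) - f p.2 (X p.1)))).
  move=> n; apply: measurable_funM => //; apply: measurable_funB.
    apply: (@measurable_caratheodory f (fun u => X u + n.+1%:R^-1 *: delta_mx 0 i)) => //.
    by apply: measurable_coordD => //; exact: measurable_coord_cst.
  exact: (@measurable_caratheodory f X).
by move=> p _; rewrite mxE; exact: derive_cvg_seq.
Qed.

End measurability_in_coordinates.

Lemma measurable_grad_fixed (R : realType) (d : nat) (dV : measure_display)
    (V : measurableType dV) (f : V -> 'rV[R]_d -> R) (x : 'rV[R]_d) :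
  (forall x, measurable_fun setT (f ^~ x)) -> (forall v x, differentiable (f v) x) ->
  measurable_coord (fun v => grad (f v) x).
Proof.
move=> mf df i.
have mg := @measurable_grad R d dV dV V V f (fun=> x) mf df
  (@measurable_coord_cst R d dV V x) i.
apply: (measurableT_comp mg (g := fun v => (v, v))).
exact: measurable_fun_pair.
Qed.

(** * Independence of a new sample from the past *)

Section freezing.
Context (R : realType) (dO dT : measure_display) (Omega : measurableType dO)
  (T : measurableType dT) (P : probability Omega R) (I : choiceType)
  (X : I -> {RV P >-> T}).

Definition cylinders (Q : set I) : set (set Omega) :=
  [set E | exists J : {fset I}, exists A : I -> set T,
     [/\ forall j, j \in J -> Q j, forall j, measurable (A j)
       & E = \bigcap_(j in [set` J]) (X j @^-1` A j)]].

(** The space [Omega] with the sigma-algebra generated by the variables of index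
    in [Q], as a measurable type of its own: product measures and Tonelli's
    theorem then apply to this sigma-algebra directly. *)
Definition past (Q : set I) : measurableType _ := g_sigma_algebraType (cylinders Q).

Lemma preimage_RV_measurable j (A : set T) :
  measurable A -> measurable (X j @^-1` A).
Proof.
move=> mA; rewrite -[X in measurable X]setTI.
exact: (@measurable_funP _ _ _ _ setT (X j)).
Qed.

Lemma cylinders_measurable Q : cylinders Q `<=` @measurable _ Omega.
Proof.
move=> _ [J [A [_ mA ->]]]; apply: fin_bigcap_measurable => // j _.
exact: preimage_RV_measurable.
Qed.

Lemma past_measurable Q (E : set (past Q)) :
  measurable E -> @measurable _ Omega E.
Proof.
apply: smallest_sub; first exact: sigma_algebra_measurable.
exact: cylinders_measurable.
Qed.

Lemma measurable_to_past Q : measurable_fun setT (id : Omega -> past Q).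
Proof. by move=> _ E mE; rewrite setTI; exact: (@past_measurable Q). Qed.

Lemma measurable_from_past Q dV (V : measurableType dV) (h : Omega -> V) :
  measurable_fun setT (h : past Q -> V) -> measurable_fun setT h.
Proof. by move=> mh; exact: (measurableT_comp mh (@measurable_to_past Q)). Qed.

Lemma measurable_past (Q : set I) j : Q j ->
  measurable_fun setT (X j : past Q -> T).
Proof.
move=> Qj _ A mA; rewrite setTI; apply: sub_sigma_algebra.
exists [fset j]%fset, (fun=> A); split => //.
  by move=> i; rewrite inE => /eqP ->.
apply/seteqP; split => [w jA i /=|w /(_ j)]; first by rewrite inE => /eqP ->.
by apply; rewrite /= inE.
Qed.

Lemma cylinders_setI Q : setI_closed (cylinders Q).
Proof.
move=> _ _ [J1 [A1 [QJ1 mA1 ->]]] [J2 [A2 [QJ2 mA2 ->]]].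
(* Each family of events is extended by [setT] outside its index set, so that the
   two families can be intersected on the union of the index sets. *)
pose A (J : {fset I}) (A : I -> set T) j := if j \in J then A j else setT.
have mA J B : (forall j, measurable (B j)) -> forall j, measurable (A J B j).
  by move=> mB j; rewrite /A; case: ifP.
exists (J1 `|` J2)%fset, (fun j => A J1 A1 j `&` A J2 A2 j); split.
- by move=> j; rewrite inE => /orP[/QJ1|/QJ2].
- by move=> j; apply: measurableI; exact: mA.
apply/seteqP; split => [w [w1 w2] j _|w w12].
  rewrite /A; split; case: ifPn => // jJ; [exact: w1|exact: w2].
split=> j jJ; have := w12 j; rewrite /= inE jJ ?orbT => /(_ isT) [];
  by rewrite /A jJ.
Qed.

Hypothesis indep : mutually_independent X.

(** For fixed [A0], both sides are finite measures in [E]. They agree on the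
    pi-system of cylinders by mutual independence, hence on the sigma-algebra
    that it generates. *)
Lemma past_independent (Q : set I) j0 (E : set (past Q)) (A0 : set T) :
  ~ Q j0 -> measurable E -> measurable A0 ->
  P ((E : set Omega) `&` X j0 @^-1` A0) = (P E * P (X j0 @^-1` A0))%E.
Proof.
move=> nQ mE mA0; have mXA := preimage_RV_measurable j0 mA0.
have PA_fin : P (X j0 @^-1` A0) \is a fin_num by exact: fin_num_measure.
have fine_ge0 : 0 <= fine (P (X j0 @^-1` A0)) by rewrite fine_ge0.
rewrite muleC -(fineK PA_fin).
apply: (@g_sigma_algebra_measure_unique _ R Omega (cylinders Q) _ (fun=> setT) _ _
  (mrestr P mXA) (mscale (NngNum fine_ge0) P)) => //=.
- exact: cylinders_measurable.
- by move=> _; exists fset0, (fun=> setT); split => //; rewrite set_fset0 bigcap_set0.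
- by rewrite bigcup_const//; exists 0%N.
- exact: cylinders_setI.
- move=> _ [J [A [QJ mA ->]]]; have j0J : j0 \notin J.
    by apply/negP => /QJ.
  pose A' j := if j == j0 then A0 else A j.
  have mA' j : measurable (A' j) by rewrite /A'; case: ifP.
  have AA' : {in J, A =1 A'}.
    by move=> j jJ; rewrite /A'; case: eqP => // jj0; rewrite -jj0 jJ in j0J.
  have A'0 : A' j0 = A0 by rewrite /A' eqxx.
  have -> : \bigcap_(j in [set` J]) (X j @^-1` A j) =
      \bigcap_(j in [set` J]) (X j @^-1` A' j).
    by apply: eq_bigcapr => j /= jJ; rewrite AA'.
  rewrite /mscale/= fineK//.
  have := indep (j0 |` J)%fset mA'; rewrite big_fsetU1//= A'0.
  rewrite -(indep J mA') => <-; congr (P _).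
  apply/seteqP; split => [w [wJ w0] j /=|w wJ].
    by rewrite inE => /orP[|jJ]; [rewrite inE => /eqP ->; rewrite A'0|exact: wJ].
  split; first by move=> j jJ; apply: wJ; rewrite /= !inE orbC; apply/orP; left.
  by rewrite -A'0; apply: wJ; rewrite /= !inE eqxx.
- move=> _; rewrite /mrestr setTI; apply: (@le_lt_trans _ _ 1%E); last exact: ltry.
  exact: probability_le1.
Qed.

(** The law of the pair (past, new sample) is the product of the marginals by
    [past_independent], and Tonelli's theorem applies to it. *)
Lemma freezing (D : probability T R) (Q : set I) j0
    (phi : past Q * T -> \bar R) :
  (forall A, measurable A -> distribution P (X j0) A = D A) ->
  ~ Q j0 -> measurable_fun setT phi -> (forall z, 0 <= phi z)%E ->
  (\int[P]_w phi (w, X j0 w) = \int[P]_w \int[D]_t phi (w, t))%E.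
Proof.
move=> XD nQ mphi phi0.
pose idQ_m := isMeasurableFun.Build _ _ _ _ _ (@measurable_to_past Q).
pose idQ : {RV P >-> past Q} := HB.pack (id : Omega -> past Q) idQ_m.
have mpair : measurable_fun setT (fun w => (w, X j0 w) : past Q * T).
  by apply: measurable_fun_pair; [exact: measurable_to_past|exact: measurable_funP].
pose pair_m := isMeasurableFun.Build _ _ _ _ _ mpair.
pose pair : {RV P >-> (past Q * T)%type} :=
  HB.pack (fun w => (w, X j0 w) : past Q * T) pair_m.
transitivity (\int[distribution P pair]_z phi z)%E.
  by rewrite ge0_integral_distribution.
transitivity (\int[distribution P idQ \x D]_z phi z)%E.
  apply: eq_measure_integral => A mA _; apply/esym.
  apply: product_measure_unique mA => E A0 mE mA0.
  have := past_independent nQ mE mA0.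
  by rewrite -[P (X j0 @^-1` A0)]/(distribution P (X j0) A0) XD.
rewrite (fubini_tonelli1 (m1 := distribution P idQ) (m2 := D) phi mphi phi0).
rewrite ge0_integral_distribution//.
  exact: measurable_fun_fubini_tonelli_F.
by move=> w; exact: integral_ge0.
Qed.

End freezing.

(** * Real-valued expectations *)

Section mean.
Context (R : realType) (dT : measure_display) (T : measurableType dT)
  (D : probability T R).
Implicit Types (c : T -> R) (r : R).

(** Integrability and the value of the integral in one statement, which turns the
    expectation into a partial linear form with values in the reals. *)
Definition has_mean c r : Prop :=
  D.-integrable setT (EFin \o c) /\ (\int[D]_t (c t)%:E = r%:E)%E.

Lemma has_meanD c1 r1 c2 r2 : has_mean c1 r1 -> has_mean c2 r2 ->
  has_mean (fun t => c1 t + c2 t) (r1 + r2).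
Proof.
move=> [i1 m1] [i2 m2]; split; first exact: (integrableD measurableT i1 i2).
by rewrite EFinD -m1 -m2; exact: (integralD_EFin measurableT i1 i2).
Qed.

Lemma has_meanZ k c r : has_mean c r -> has_mean (fun t => k * c t) (k * r).
Proof.
move=> [ic mc]; split; first exact: (integrableZl measurableT k ic).
by rewrite EFinM -mc; exact: (integralZl measurableT ic k).
Qed.

Lemma has_meanB c1 r1 c2 r2 : has_mean c1 r1 -> has_mean c2 r2 ->
  has_mean (fun t => c1 t - c2 t) (r1 - r2).
Proof.
move=> h1 /(has_meanZ (-1)); rewrite mulN1r => /(has_meanD h1).
by under [X in has_mean X]funext do rewrite mulN1r.
Qed.

Lemma has_mean_cst r : has_mean (fun=> r) r.
Proof.
split; first exact: finite_measure_integrable_cst.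
by rewrite integral_cst// [X in (_ * X)%E]probability_setT mule1.
Qed.

Lemma has_mean_sum (I : Type) (s : seq I) (c : I -> T -> R) (r : I -> R) :
  (forall i, has_mean (c i) (r i)) ->
  has_mean (fun t => \sum_(i <- s) c i t) (\sum_(i <- s) r i).
Proof.
move=> cr; elim: s => [|i s IHs].
  rewrite big_nil; under [X in has_mean X]funext do rewrite big_nil.
  exact: has_mean_cst.
rewrite big_cons; under [X in has_mean X]funext do rewrite big_cons.
exact: has_meanD.
Qed.

Lemma has_mean_ge0 c r : has_mean c r -> {ae D, forall t, 0 <= c t} -> 0 <= r.
Proof.
move=> [ic mc] c0; rewrite -lee_fin -mc.
have mEc := measurable_int D ic.
rewrite (ae_eq_integral (fun t => maxe (EFin (c t)) 0%E))//.
- by apply: integral_ge0 => t _; rewrite le_max lexx orbT.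
- by apply: measurable_maxe => //; exact: measurable_cst.
- by apply: filterS c0 => t c0 _ /=; rewrite max_l// lee_fin.
Qed.

Lemma has_mean_le c1 r1 c2 r2 : has_mean c1 r1 -> has_mean c2 r2 ->
  {ae D, forall t, c1 t <= c2 t} -> r1 <= r2.
Proof.
move=> h1 h2 c12; rewrite -subr_ge0; apply: (has_mean_ge0 (has_meanB h2 h1)).
by apply: filterS c12 => t; rewrite subr_ge0.
Qed.

End mean.

(** * The expected function and the noise of one sample *)

Section population.
Context (R : realType) (d : nat) (dT : measure_display) (T : measurableType dT)
  (D : probability T R) (f : T -> 'rV[R]_d -> R) (F : 'rV[R]_d -> R)
  (xs : 'rV[R]_d) (H0 H1 rho : R).
Hypotheses (f_int : forall x, D.-integrable setT (fun t => (f t x)%:E))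
  (F_def : forall x, ('E_D[fun t => f t x] = (F x)%:E)%E)
  (f_diff : forall t x, differentiable (f t) x)
  (F_diff : forall x, differentiable F x)
  (xs_min : forall y, F xs <= F y)
  (H0_ge0 : 0 <= H0) (H1_ge0 : 0 <= H1)
  (f_smooth : {ae D, forall t, H0H1_smooth H0 H1 (f t)})
  (f_convex : {ae D, forall t, grad_convex (f t)})
  (f_unbiased : unbiased D f F)
  (f_sgc : strong_growth D f F rho).

Lemma measurable_sample x : measurable_fun setT (fun t => f t x).
Proof. by apply/measurable_EFinP; exact: measurable_int (f_int x). Qed.

Lemma measurable_grad_sample x : measurable_coord (fun t => grad (f t) x).
Proof. exact: measurable_grad_fixed measurable_sample f_diff. Qed.

Lemma has_mean_sample x : has_mean D (fun t => f t x) (F x).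
Proof. by split; [exact: f_int|have := F_def x; rewrite unlock]. Qed.

(** Only an upper bound on the second moment is known, whence the extra [M]. *)
Lemma has_mean_grad_sqr x : exists2 M, M <= rho * norm2 (grad F x) ^+ 2 &
  has_mean D (fun t => norm2 (grad (f t) x) ^+ 2) M.
Proof.
have mg : measurable_fun setT (fun t => norm2 (grad (f t) x) ^+ 2).
  exact/measurable_funX/measurable_norm2/measurable_grad_sample.
have := f_sgc x; rewrite unlock => sgc.
have int_g : D.-integrable setT (EFin \o (fun t => norm2 (grad (f t) x) ^+ 2)).
  apply/integrableP; split; first exact/measurable_EFinP.
  apply: (@le_lt_trans _ _ (rho * norm2 (grad F x) ^+ 2)%:E); last exact: ltry.
  apply: le_trans sgc; rewrite le_eqVlt; apply/orP; left; apply/eqP.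
  by apply: eq_integral => t _ /=; rewrite ger0_norm// sqr_ge0.
exists (fine (\int[D]_t (norm2 (grad (f t) x) ^+ 2)%:E)).
  by rewrite -lee_fin fineK//; exact: integrable_fin_num.
by split => //; rewrite fineK//; exact: integrable_fin_num.
Qed.

Lemma has_mean_grad x i :
  has_mean D (fun t => grad (f t) x 0 i) (grad F x 0 i).
Proof.
have [M _ [int_g _]] := has_mean_grad_sqr x.
split; last by have := f_unbiased x i; rewrite unlock.
have [int1 _] := has_mean_cst D 1.
apply: le_integrable (integrableD measurableT int1 int_g) => //.
  by apply/measurable_EFinP; exact: measurable_grad_sample.
move=> t _ /=; rewrite lee_fin.
rewrite [leRHS]ger0_norm ?addr_ge0 ?sqr_ge0//.
apply: le_trans (coord_le_norm2 _ i) _; set n := norm2 _.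
have := sqr_ge0 (n - 1); have : 0 <= n := norm2_ge0 _; nra.
Qed.

Lemma has_mean_dotp_grad x v :
  has_mean D (fun t => dotp (grad (f t) x) v) (dotp (grad F x) v).
Proof.
apply: has_mean_sum => i.
under [X in has_mean D X]funext do rewrite mulrC.
by rewrite mulrC; apply: has_meanZ; exact: has_mean_grad.
Qed.

(** Conditional second moment of a sum of errors when one sample is added: the
    cross term vanishes by unbiasedness, and the variance of a sample gradient is
    its second moment minus [norm2 (grad F x) ^+ 2]. *)
Lemma noise_second_moment x s :
  (\int[D]_t (norm2 (s + (grad (f t) x - grad F x)) ^+ 2)%:E <=
   (norm2 s ^+ 2 + (rho - 1) * norm2 (grad F x) ^+ 2)%:E)%E.
Proof.
have [M M_le hM] := has_mean_grad_sqr x.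
set a := s - grad F x; set G := norm2 (grad F x).
have := has_meanD (has_mean_cst D (norm2 a ^+ 2))
  (has_meanD (has_meanZ 2 (has_mean_dotp_grad x a)) hM).
move=> [_ E]; rewrite (eq_integral (fun t =>
  (norm2 a ^+ 2 + (2 * dotp (grad (f t) x) a + norm2 (grad (f t) x) ^+ 2))%:E)).
  rewrite E lee_fin norm2B_sqr -/G dotpBr -norm2_sqr -/G (dotpC s).
  by move: M_le; rewrite -/G; lra.
move=> t _; congr (_%:E).
rewrite (_ : s + _ = a + grad (f t) x); first by rewrite norm2D_sqr dotpC; ring.
by rewrite /a addrA addrAC.
Qed.

Lemma grad_min : grad F xs = 0.
Proof. exact: grad_eq0_min. Qed.

(** The strong growth condition at [xs] makes the second moment of the sample
    gradient zero. *)
Lemma ae_grad_min : {ae D, forall t, grad (f t) xs = 0}.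
Proof.
have [M M_le [int_g EM]] := has_mean_grad_sqr xs.
have M0 : M = 0.
  apply/eqP; rewrite eq_le; apply/andP; split.
    by apply: le_trans M_le _; rewrite grad_min norm2_sqr dotp0l mulr0.
  by rewrite -lee_fin -EM integral_ge0// => t _; rewrite lee_fin sqr_ge0.
have [+ _] := @ae_eq_integral_abs _ _ _ D setT measurableT _ (measurable_int D int_g).
under eq_integral do rewrite /= ger0_norm ?sqr_ge0//.
rewrite EM M0 => /(_ erefl); apply: filterS => t /(_ I) /= [gt0].
by apply: norm2_eq0P; apply/eqP; rewrite -sqrf_eq0 gt0.
Qed.

Lemma ae_sample_model :
  {ae D, forall t, smooth_convex_model H0 H1 xs (f t) (grad (f t))}.
Proof.
apply: filterS3 f_smooth f_convex ae_grad_min => t sm cv g0.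
exact: smooth_convex_model_grad.
Qed.

Lemma population_model : smooth_convex_model H0 H1 xs F (grad F).
Proof.
split=> [x y|x y xy|//].
- apply: (has_mean_le (has_meanD (has_mean_sample x) (has_mean_dotp_grad x (y - x)))
    (has_mean_sample y)).
  by apply: filterS ae_sample_model => t [+ _ _]; apply.
- have hL := has_meanZ (norm2 (y - x) ^+ 2 / 2) (has_meanD (has_mean_cst D H0)
    (has_meanZ H1 (has_meanB (has_mean_sample x) (has_mean_sample xs)))).
  have hR := has_meanD (has_meanD (has_mean_sample x)
    (has_mean_dotp_grad x (y - x))) hL.
  apply: le_trans (has_mean_le (has_mean_sample y) hR _) _; last by lra.
  apply: filterS ae_sample_model => t [_ + _] => /(_ x y xy) /le_trans; apply.
  by lra.
Qed.

(** A measurable set of full measure is needed to transport the property along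
    the samples. *)
Lemma good_samples : exists2 G : set T, measurable G /\ D (~` G) = 0 &
  forall t, G t -> smooth_convex_model H0 H1 xs (f t) (grad (f t)).
Proof.
have [N [mN N0 subN]] := ae_sample_model.
exists (~` N); first by rewrite setCK; split => //; exact: measurableC.
by move=> t Nt; apply: contrapT => /subN.
Qed.

End population.

(** * Integrability by domination *)

Section domination.
Context (R : realType) (dT : measure_display) (T : measurableType dT)
  (D : probability T R).
Implicit Types (c : T -> R) (r : R).

Lemma has_mean_bounded c r : measurable_fun setT c -> (forall t, 0 <= c t) ->
  (\int[D]_t (c t)%:E <= r%:E)%E -> exists2 r', r' <= r & has_mean D c r'.
Proof.
move=> mc c0 cr.
have ic : D.-integrable setT (EFin \o c).
  apply/integrableP; split; first exact/measurable_EFinP.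
  under eq_integral do rewrite /= ger0_norm//.
  by apply: le_lt_trans cr _; exact: ltry.
exists (fine (\int[D]_t (c t)%:E)).
  by rewrite -lee_fin fineK//; exact: integrable_fin_num.
by split => //; rewrite fineK//; exact: integrable_fin_num.
Qed.

Lemma has_mean_dominated c c' r' : measurable_fun setT c ->
  (forall t, 0 <= c t) -> has_mean D c' r' -> {ae D, forall t, c t <= c' t} ->
  exists2 r, r <= r' & has_mean D c r.
Proof.
move=> mc c0 h' cc'; have [ic' _] := h'.
have /integrableP[mc' lty] := ic'.
have [||r _ hr] := @has_mean_bounded c (fine (\int[D]_t `|(c' t)%:E|)) mc.
- exact: c0.
- rewrite fineK; last by rewrite ge0_fin_numE//; apply: integral_ge0 => t _.
  apply: ae_ge0_le_integral => //.
  + by move=> t _; rewrite lee_fin.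
  + exact/measurable_EFinP.
  + exact: measurableT_comp.
  by apply: filterS cc' => t ct _; rewrite lee_fin (le_trans ct)// ler_norm.
by exists r => //; exact: has_mean_le cc'.
Qed.

Lemma has_mean_inj c r r' : has_mean D c r -> has_mean D c r' -> r = r'.
Proof. by move=> [_ e] [_]; rewrite e => -[]. Qed.

Lemma measurable_fun_inv_ge0 c : measurable_fun setT c -> (forall t, 0 <= c t) ->
  measurable_fun setT (fun t => (c t)^-1).
Proof.
move=> mc c0; rewrite (_ : (fun t => _) = (fun t => c t `^ (- 1))).
  exact: (measurableT_comp (measurable_powR (- 1)) mc).
by apply/funext => t; rewrite powR_inv1.
Qed.

End domination.

(** * The iterates of the stochastic method *)

Section process.
Context (R : realType) (d : nat) (dT : measure_display) (T : measurableType dT)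
  (D : probability T R) (f : T -> 'rV[R]_d -> R) (F : 'rV[R]_d -> R)
  (xs : 'rV[R]_d) (H0 H1 rho : R).
Context (dO : measure_display) (Omega : measurableType dO)
  (P : probability Omega R) (B : nat) (xi : nat -> 'I_B -> {RV P >-> T})
  (x0 : 'rV[R]_d) (lambda eta R0 : R).
Hypotheses
  (mf : forall x, measurable_fun setT (f ^~ x))
  (f_diff : forall t x, differentiable (f t) x)
  (F_diff : forall x, differentiable F x)
  (F_model : smooth_convex_model H0 H1 xs F (grad F))
  (noise : forall x s,
    (\int[D]_t (norm2 (s + (grad (f t) x - grad F x)) ^+ 2)%:E <=
     (norm2 s ^+ 2 + (rho - 1) * norm2 (grad F x) ^+ 2)%:E)%E)
  (lambda_gt0 : 0 < lambda) (B_gt0 : (0 < B)%N) (B_ge : 64 * (rho - 1) <= B%:R)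
  (xi_law : forall k i A, measurable A -> distribution P (xi k i) A = D A)
  (xi_indep : mutually_independent (fun ki : nat * 'I_B => xi ki.1 ki.2)).

Let XI (ki : nat * 'I_B) : {RV P >-> T} := xi ki.1 ki.2.
Let X k w := nsgd f eta lambda x0 (fun k i => xi k i w) k.
Let G k w := norm2 (grad F (X k w)).
Let gap k w := F (X k w) - F xs.
Let bgrad k w := batch_grad f (X k w) (fun i => xi k i w).
Let err k i w := grad (f (xi k i w)) (X k w) - grad F (X k w).
(* The samples of a batch are processed one at a time: [errs k m] is the sum of
   the errors of the first [m] samples at iteration [k], and [drawn k m] is the
   set of indices of the samples drawn before the next one. *)
Let errs k m w := \sum_(i < B | (i < m)%N) err k i w.
Let drawn k m : set (nat * 'I_B) :=
  [set ki : nat * 'I_B | (ki.1 < k)%N || (ki.1 == k) && (ki.2 < m)%N].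

Lemma errsS k m (mB : (m < B)%N) w :
  errs k m.+1 w = errs k m w + err k (Ordinal mB) w.
Proof.
rewrite /errs (bigD1 (Ordinal mB))//= addrC; congr (_ + _).
apply: eq_bigl => i; rewrite -(inj_eq val_inj) /= ltnS.
by rewrite [RHS]ltn_neqAle andbC.
Qed.

Section adapted.
Variable Q : set (nat * 'I_B).

Lemma measurable_grad_at (Y : past XI Q -> 'rV[R]_d) k i :
  measurable_coord Y -> Q (k, i) ->
  measurable_coord (fun w : past XI Q => grad (f (xi k i w)) (Y w)).
Proof.
move=> mY Qki j.
apply: (measurableT_comp (measurable_grad mf f_diff mY j)
  (g := fun w : past XI Q => (w, xi k i w))).
by apply: measurable_fun_pair => //; exact: (@measurable_past _ _ _ _ _ _ _ XI Q (k, i)).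
Qed.

Lemma measurable_nsgd k : (forall ki, (ki.1 < k)%N -> Q ki) ->
  @measurable_coord R d _ (past XI Q) (X k).
Proof.
elim: k => [|k IHk] Qk; first exact: measurable_coord_cst.
have mX : @measurable_coord R d _ (past XI Q) (X k).
  by apply: IHk => ki ?; apply: Qk; exact: ltnW.
have mg : @measurable_coord R d _ (past XI Q) (bgrad k).
  apply: measurable_coordZ; first exact: measurable_cst.
  by apply: measurable_coord_sum => i; apply: measurable_grad_at => //; exact: Qk.
apply: measurable_coordB => //; apply: measurable_coordZ => //.
apply: measurable_funM => //; apply: measurable_fun_inv_ge0.
  by apply: measurable_funD => //; exact: measurable_norm2.
by move=> w; rewrite addr_ge0 ?norm2_ge0// ltW.
Qed.

Lemma measurable_grad_nsgd k : (forall ki, (ki.1 < k)%N -> Q ki) ->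
  @measurable_coord R d _ (past XI Q) (fun w => grad F (X k w)).
Proof.
move=> Qk j; have := @measurable_grad R d _ _ (past XI Q) T (fun=> F) _
  (fun=> measurable_cst _) (fun=> F_diff) (measurable_nsgd Qk) j.
move=> mg; apply: (measurableT_comp mg (g := fun w : past XI Q => (w, point))).
exact: measurable_fun_pair.
Qed.

Lemma measurable_errs k m : (forall ki, (ki.1 < k)%N -> Q ki) ->
  (forall i : 'I_B, (i < m)%N -> Q (k, i)) ->
  @measurable_coord R d _ (past XI Q) (errs k m).
Proof.
move=> Qk Qm; elim: m Qm => [|m IHm] Qm.
  rewrite (_ : errs k 0 = fun=> 0); first exact: measurable_coord_cst.
  by apply/funext => w; rewrite /errs big_pred0.
have {}IHm : @measurable_coord R d _ (past XI Q) (errs k m).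
  by apply: IHm => i im; apply: Qm; exact: ltnW.
have [mB|Bm] := ltnP m B; last first.
  rewrite (_ : errs k m.+1 = errs k m)//; apply/funext => w.
  by apply: eq_bigl => i; rewrite !(leq_trans (ltn_ord i)) ?ltnS// ltnW.
rewrite (_ : errs k m.+1 = fun w => errs k m w + err k (Ordinal mB) w).
  apply: measurable_coordD => //; apply: measurable_coordB.
    by apply: measurable_grad_at; [exact: measurable_nsgd|exact: Qm].
  exact: measurable_grad_nsgd.
apply/funext => w; exact: errsS.
Qed.

End adapted.

Let drawn_lt k m ki : (ki.1 < k)%N -> drawn k m ki.
Proof. by rewrite /drawn /= => ->. Qed.

Lemma measurable_gradnorm k : measurable_fun setT (G k).
Proof.
apply: (@measurable_from_past _ _ _ _ _ _ _ XI setT); apply: measurable_norm2.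
exact: measurable_grad_nsgd.
Qed.

Lemma measurable_gap k : measurable_fun setT (gap k).
Proof.
apply: (@measurable_from_past _ _ _ _ _ _ _ XI setT).
apply: measurable_funB; last exact: measurable_cst.
have cF : continuous F by move=> x; exact: differentiable_continuous.
have := @measurable_caratheodory R d _ _ (past XI setT) T (fun=> F) (X k)
  (fun=> measurable_cst _) (fun=> cF) (measurable_nsgd (fun _ _ => I)).
move=> mF; apply: (measurableT_comp mF (g := fun w : past XI setT => (w, point))).
exact: measurable_fun_pair.
Qed.

(* Young's inequality bounds [|e|] by [4 w |e|^2 + (G + delta) / 16] with the
   weight [w = 1 / (G + delta)]; [delta > 0] covers the case [G = 0]. *)
Let weight delta k w := (G k w + delta)^-1.

Section noise.
Variables (delta : R) (k : nat) (b : R).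
Hypotheses (delta_gt0 : 0 < delta) (G_mean : has_mean P (G k) b).

Lemma weight_ge0 w : 0 <= weight delta k w.
Proof. by rewrite invr_ge0 addr_ge0 ?norm2_ge0// ltW. Qed.

Lemma measurable_weight Q : (forall ki : nat * 'I_B, (ki.1 < k)%N -> Q ki) ->
  measurable_fun setT (weight delta k : past XI Q -> R).
Proof.
move=> Qk; apply: measurable_fun_inv_ge0.
  by apply: measurable_funD => //; apply: measurable_norm2; exact: measurable_grad_nsgd.
by move=> w; rewrite addr_ge0 ?norm2_ge0// ltW.
Qed.

Lemma weighted_grad_mean : exists2 r, 0 <= r <= b &
  has_mean P (fun w => weight delta k w * G k w ^+ 2) r.
Proof.
have c0 w : 0 <= weight delta k w * G k w ^+ 2.
  by rewrite mulr_ge0 ?weight_ge0// sqr_ge0.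
have [||r rb hr] := has_mean_dominated _ c0 G_mean.
- apply: measurable_funM; last exact/measurable_funX/measurable_gradnorm.
  apply: (@measurable_from_past _ _ _ _ _ _ _ XI setT).
  exact: measurable_weight.
- apply: nearW => w; rewrite /weight; have G0 : 0 <= G k w := norm2_ge0 _.
  rewrite mulrC ler_pdivrMr; last by rewrite ltr_wpDl.
  by rewrite expr2 ler_wpM2l// lerDl ltW.
by exists r => //; rewrite rb andbT; apply: has_mean_ge0 hr _; exact: nearW.
Qed.

(** Each sample adds at most [(rho - 1) E (w G^2)] to the weighted second moment:
    the weight and the partial sum depend on the past of that sample, so that
    [freezing] reduces the claim to the bound [noise] for a frozen iterate. *)
Lemma partial_noise m r : (m <= B)%N ->
  has_mean P (fun w => weight delta k w * G k w ^+ 2) r ->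
  exists2 v, v <= m%:R * ((rho - 1) * r) &
    has_mean P (fun w => weight delta k w * norm2 (errs k m w) ^+ 2) v.
Proof.
move=> + hr; elim: m => [|m IHm] mB.
  exists 0; first by rewrite mul0r.
  rewrite (_ : (fun w => _) = cst 0); first exact: has_mean_cst.
  by apply/funext => w; rewrite /errs big_pred0// norm2_sqr dotp0l mulr0.
have [v v_le hv] := IHm (ltnW mB).
pose Q := drawn k m; have Qk ki : (ki.1 < k)%N -> Q ki by exact: drawn_lt.
have Qm (i : 'I_B) : (i < m)%N -> Q (k, i).
  by move=> im; rewrite /Q /drawn /= eqxx im orbT.
have nQ : ~ Q (k, Ordinal mB) by rewrite /Q /drawn /= !ltnn andbF.
have hv' := has_meanD hv (has_meanZ (rho - 1) hr).
have [|w||v' v'_le hv''] := @has_mean_bounded _ _ _ P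
  (fun w => weight delta k w * norm2 (errs k m.+1 w) ^+ 2) (v + (rho - 1) * r).
- apply: (@measurable_from_past _ _ _ _ _ _ _ XI setT).
  apply: measurable_funM; first exact: measurable_weight.
  by apply/measurable_funX/measurable_norm2; exact: measurable_errs.
- by rewrite mulr_ge0 ?weight_ge0// sqr_ge0.
- pose phi (z : past XI Q * T) : \bar R := (weight delta k z.1 *
    norm2 (errs k m z.1 + (grad (f z.2) (X k z.1) - grad F (X k z.1))) ^+ 2)%:E.
  have mfst (h : past XI Q -> R) : measurable_fun setT h ->
      measurable_fun setT (fun z : past XI Q * T => h z.1).
    by move=> mh; exact: (measurableT_comp mh measurable_fst).
  have mphi : measurable_fun setT phi.
    apply/measurable_EFinP; apply: measurable_funM.
      by apply: mfst; exact: measurable_weight.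
    apply/measurable_funX/measurable_norm2/measurable_coordD.
      by move=> j; apply: (mfst (fun w => errs k m w 0 j)); exact: measurable_errs.
    apply: measurable_coordB; first exact: measurable_grad (measurable_nsgd Qk).
    move=> j; apply: (mfst (fun w => grad F (X k w) 0 j)).
    exact: measurable_grad_nsgd.
  have phi0 z : (0 <= phi z)%E.
    by rewrite lee_fin mulr_ge0 ?weight_ge0// sqr_ge0.
  have frz := @freezing _ _ _ _ _ _ _ XI xi_indep D Q (k, Ordinal mB) phi
    (xi_law k (Ordinal mB)) nQ mphi phi0.
  rewrite (eq_integral (fun w => phi (w, xi k (Ordinal mB) w))); last first.
    by move=> w _; rewrite (errsS k mB).
  rewrite frz -hv'.2; apply: ge0_le_integral => //.
  + by move=> w _; apply: integral_ge0 => t _; exact: phi0.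
  + exact: (measurable_from_past (measurable_fun_fubini_tonelli_F (m2 := D) phi mphi phi0)).
  + exact: measurable_int hv'.1.
  move=> w _; pose psi t : R :=
    norm2 (errs k m w + (grad (f t) (X k w) - grad F (X k w))) ^+ 2.
  have mpsi : measurable_fun setT psi.
    apply/measurable_funX/measurable_norm2/measurable_coordD.
      exact: measurable_coord_cst.
    apply: measurable_coordB; last exact: measurable_coord_cst.
    exact: measurable_grad_fixed.
  rewrite (eq_integral (fun t => ((weight delta k w)%:E * (psi t)%:E)%E)); last first.
    by move=> t _; rewrite -EFinM.
  rewrite ge0_integralZl_EFin//.
  + have -> : weight delta k w * norm2 (errs k m w) ^+ 2 +
       (rho - 1) * (weight delta k w * G k w ^+ 2) =
       weight delta k w * (norm2 (errs k m w) ^+ 2 + (rho - 1) * G k w ^+ 2) by ring.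
    by rewrite EFinM lee_wpmul2l ?lee_fin ?weight_ge0//; exact: noise.
  + by move=> t _; rewrite lee_fin sqr_ge0.
  + exact/measurable_EFinP.
  + exact: weight_ge0.
exists v' => //; apply: le_trans v'_le _.
by rewrite -[m.+1%:R]natr1 [leRHS]mulrDl mul1r lerD2r.
Qed.

End noise.

Lemma bgrad_err k w : bgrad k w - grad F (X k w) = B%:R^-1 *: errs k B w.
Proof.
have B0 : B%:R != 0 :> R by rewrite pnatr_eq0 -lt0n.
rewrite /bgrad /batch_grad /errs.
under [X in _ = _ *: X]eq_bigl do rewrite ltn_ord.
rewrite /err big_split/= sumrN sumr_const card_ord scalerBr; congr (_ - _).
by rewrite -[grad _ _ *+ B]scaler_nat scalerA mulVf// scale1r.
Qed.

Let noise_norm k w := norm2 (bgrad k w - grad F (X k w)).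

Lemma measurable_noise_norm k : measurable_fun setT (noise_norm k).
Proof.
rewrite /noise_norm; under eq_fun do rewrite bgrad_err.
apply: (@measurable_from_past _ _ _ _ _ _ _ XI setT); apply: measurable_norm2.
apply: measurable_coordZ; first exact: measurable_cst.
exact: measurable_errs.
Qed.

(** The weighted second moment of the batch error is at most
    [(rho - 1) / B] times [E (w G^2) <= b], that is at most [b / 64]; Young's
    inequality for [weight delta] concludes. *)
Lemma noise_mean_delta k b delta : 0 < delta -> has_mean P (G k) b ->
  exists2 c, c <= b / 8 + delta / 16 & has_mean P (noise_norm k) c.
Proof.
move=> delta_gt0 hG.
have [r /andP[r0 rb] hr] := weighted_grad_mean delta_gt0 hG.
have [v v_le hv] := partial_noise delta_gt0 (leqnn B) hr.
have B0 : 0 < B%:R :> R by rewrite ltr0n.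
have := has_meanD (has_meanZ (4 * B%:R^-1 ^+ 2) hv)
  (has_meanZ 16^-1 (has_meanD hG (has_mean_cst P delta))).
move=> /(has_mean_dominated (measurable_noise_norm k) (fun w => norm2_ge0 _)).
case.
  apply: nearW => w; rewrite /noise_norm bgrad_err norm2Z ger0_norm ?invr_ge0 ?(ltW B0)//.
  rewrite /weight; set n := norm2 (errs k B w); set g := G k w.
  have g0 : 0 < g + delta by rewrite ltr_wpDl ?norm2_ge0.
  set iB := B%:R^-1; set q := g + delta in g0 *.
  (* Young's inequality, as the square of [2 |e| / sqrt q - sqrt q / 4]. *)
  have : 0 <= (iB * n * 2 - q / 4) ^+ 2 / q by rewrite divr_ge0 ?sqr_ge0// ltW.
  have -> : (iB * n * 2 - q / 4) ^+ 2 / q =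
     4 * iB ^+ 2 * (q^-1 * n ^+ 2) - iB * n + 16^-1 * q.
    by field; rewrite gt_eqF.
  by lra.
move=> c c_le hc; exists c => //; apply: le_trans c_le _.
have : B%:R^-1 ^+ 2 * v <= b / 64.
  apply: (@le_trans _ _ (B%:R^-1 ^+ 2 * (B%:R * ((rho - 1) * r)))).
    by rewrite ler_wpM2l// sqr_ge0.
  apply: (@le_trans _ _ (r / 64)); last by rewrite ler_pM2r.
  have -> : B%:R^-1 ^+ 2 * (B%:R * ((rho - 1) * r)) = r * (64 * (rho - 1) / B%:R) / 64.
    by field; rewrite gt_eqF.
  by rewrite ler_pM2r// ler_piMr// ler_pdivrMr// mul1r.
by lra.
Qed.

Lemma noise_mean k b : has_mean P (G k) b ->
  exists2 c, c <= b / 8 & has_mean P (noise_norm k) c.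
Proof.
move=> hG; have [c _ hc] := noise_mean_delta ltr01 hG.
exists c => //; apply/ler_addgt0Pr => e e0.
have e16 : 0 < 16 * e by rewrite mulr_gt0.
have [c' c'_le hc'] := noise_mean_delta e16 hG.
by rewrite (has_mean_inj hc hc'); lra.
Qed.

Hypotheses (H0_ge0 : 0 <= H0) (H1_ge0 : 0 <= H1) (eta_gt0 : 0 < eta)
  (eta_H0 : eta * H0 <= lambda) (eta_R0 : eta * H1 * R0 <= 1)
  (eta_H1 : H1 * eta ^+ 2 <= 1) (x0_R0 : norm2 (x0 - xs) <= R0).
Variable good : set T.
Hypotheses (good_measurable : measurable good) (good_full : D (~` good) = 0%E)
  (good_model : forall t, good t -> smooth_convex_model H0 H1 xs (f t) (grad (f t))).

Lemma ae_good : {ae P, forall w, forall k i, good (xi k i w)}.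
Proof.
apply: ae_foralln => k; apply: filter_forall => i.
exists (xi k i @^-1` ~` good); split => //.
  by apply: (preimage_RV_measurable XI (k, i)); exact: measurableC.
by rewrite -good_full -(xi_law k i (measurableC good_measurable)).
Qed.

(** Along good samples, each batch average is a model with minimiser [xs]. *)
Lemma nsgd_dist w : (forall k i, good (xi k i w)) ->
  forall k, norm2 (X k w - xs) <= R0.
Proof.
move=> gw; elim=> [//|k IHk]; apply: le_trans (IHk).
have := smooth_convex_model_avg B_gt0 (fun i => good_model (gw k i)).
move=> /(model_step_dist H1_ge0 eta_gt0 lambda_gt0 eta_H0 eta_R0 eta_H1).
by move=> /(_ _ IHk).
Qed.

Lemma ae_nsgd_dist : {ae P, forall w, forall k, norm2 (X k w - xs) <= R0}.
Proof. by apply: filterS ae_good; exact: nsgd_dist. Qed.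

Lemma gap_ge0 k w : 0 <= gap k w.
Proof. by have [_ _ xs_min] := F_model; rewrite subr_ge0. Qed.

(** Expectation of [model_noisy_step]. The mean [b] of the gradient norm is kept
    in the conclusion; its finiteness, which allows cancelling it, comes from
    [model_grad_le]. *)
Lemma nsgd_one_step k a : has_mean P (gap k) a ->
  exists a' b, [/\ has_mean P (gap k.+1) a', a <= R0 * b &
    a' + eta / 4 * b <= a + 3 / 2 * eta * lambda].
Proof.
move=> ha.
have [|b _ hb] := has_mean_dominated (measurable_gradnorm k) (fun w => norm2_ge0 _)
    (has_meanD (has_meanZ (2 / eta) ha) (has_mean_cst P lambda)).
  apply: filterS ae_nsgd_dist => w dist.
  exact: (model_grad_le H1_ge0 eta_gt0 lambda_gt0 eta_H0 eta_R0 eta_H1 F_model (dist k)).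
have [c c_le hc] := noise_mean hb.
have hR := has_meanD (has_meanD ha (has_meanZ (2 * eta) hc))
  (has_mean_cst P (3 / 2 * eta * lambda)).
have step : {ae P, forall w, gap k.+1 w + eta / 2 * G k w <=
    gap k w + 2 * eta * noise_norm k w + 3 / 2 * eta * lambda}.
  apply: filterS ae_nsgd_dist => w dist.
  exact: (model_noisy_step H0_ge0 H1_ge0 eta_gt0 lambda_gt0 eta_H0 eta_R0 eta_H1
    F_model (dist k)).
have [|a' _ ha'] := has_mean_dominated (measurable_gap k.+1) (gap_ge0 k.+1) hR.
  apply: filterS step => w; apply: le_trans; rewrite lerDl mulr_ge0 ?norm2_ge0//.
  by rewrite divr_ge0// ltW.
exists a', b; split => //.
  apply: (has_mean_le ha (has_meanZ R0 hb)).
  apply: filterS ae_nsgd_dist => w dist; rewrite mulrC.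
  by have /andP[_] := model_gap_le F_model (dist k).
have := has_mean_le (has_meanD ha' (has_meanZ (eta / 2) hb)) hR step.
have : eta * c <= eta * (b / 8) by rewrite ler_pM2l.
lra.
Qed.

(** The recursion [a' <= q a + (1 - q) (6 lambda R0)] with
    [q = 1 - eta / (4 R0)]. *)
Lemma nsgd_gap_rate N : 0 < R0 -> eta <= 4 * R0 ->
  exists2 a, has_mean P (gap N) a &
    a <= (1 - eta / (4 * R0)) ^+ N * (F x0 - F xs) + 6 * lambda * R0.
Proof.
move=> R0_gt0 eta_le4.
have q0 : 0 <= 1 - eta / (4 * R0).
  by rewrite subr_ge0 ler_pdivrMr ?mulr_gt0// mul1r.
elim: N => [|N [a ha a_le]].
  exists (F x0 - F xs); first exact: (has_mean_cst P (F x0 - F xs)).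
  by rewrite expr0 mul1r lerDl !mulr_ge0// ltW.
have [a' [b [ha' ab step]]] := nsgd_one_step ha.
exists a' => //; have bge : a / R0 <= b by rewrite ler_pdivrMr// mulrC.
apply: (@le_trans _ _ ((1 - eta / (4 * R0)) * a + 3 / 2 * eta * lambda)).
  have : eta / 4 * (a / R0) <= eta / 4 * b by rewrite ler_pM2l// divr_gt0.
  have -> : (1 - eta / (4 * R0)) * a = a - eta / 4 * (a / R0).
    by field; rewrite gt_eqF.
  by lra.
have := ler_wpM2l q0 a_le; rewrite exprS.
have -> : 3 / 2 * eta * lambda = (1 - (1 - eta / (4 * R0))) * (6 * lambda * R0).
  by field; rewrite gt_eqF.
set q := 1 - eta / _; set A := q ^+ N; set C := F x0 - F xs; lra.
Qed.

(** As [R0 < eta], the whole ball of radius [R0] lies in the range of the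
    quadratic upper bound at [xs], which gives a gap of at most [H0 R0^2 / 2];
    and [4 R0 H0 <= eta H0 <= lambda]. *)
Lemma nsgd_gap_large_step N : grad F xs = 0 -> 4 * R0 < eta ->
  exists2 a, has_mean P (gap N) a & a <= lambda * R0.
Proof.
move=> gxs R0_small.
have R0_ge0 : 0 <= R0 := le_trans (norm2_ge0 _) x0_R0.
have [_ desc _] := F_model.
have gap_le : {ae P, forall w, gap N w <= lambda * R0}.
  apply: filterS ae_nsgd_dist => w /(_ N) dist.
  have dist2 : norm2 (X N w - xs) ^+ 2 <= R0 ^+ 2.
    by rewrite ler_pXn2r// ?nnegrE ?norm2_ge0.
  have R0_eta : R0 ^+ 2 <= eta ^+ 2.
    rewrite ler_pXn2r// ?nnegrE//; first by move: (R0_small) (R0_ge0); lra.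
    exact: ltW.
  have := desc xs (X N w); rewrite gxs dotp0l subrr mulr0 !addr0 => F_le.
  rewrite lerBlDl; apply: le_trans (F_le _) _.
    by apply: le_trans eta_H1; rewrite ler_wpM2l// (le_trans dist2).
  rewrite lerD2l; apply: (@le_trans _ _ (H0 / 2 * R0 ^+ 2)).
    by rewrite ler_wpM2l// divr_ge0.
  have : H0 * (4 * R0) <= H0 * eta by rewrite ler_wpM2l// ltW.
  move=> /le_trans /(_ _) H; have {}H : H0 * (4 * R0) <= lambda.
    by apply: H; rewrite mulrC.
  by have := ler_wpM2r R0_ge0 H; have : 0 <= lambda * R0 by [rewrite mulr_ge0// ltW]; lra.
have [a a_le ha] := has_mean_dominated (measurable_gap N) (gap_ge0 N)
  (has_mean_cst P (lambda * R0)) gap_le.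
by exists a.
Qed.

End process.

(** * Convergence rate *)

Lemma nsgd_step_constants (R : realType) (H0 H1 R0 lambda eta : R) :
  0 <= H0 -> 0 <= H1 -> 0 <= R0 -> 0 < lambda -> 0 < eta ->
  eta <= lambda / (H0 + Num.max (Num.sqrt H1) (H1 * R0) * lambda) ->
  [/\ eta * H0 <= lambda, eta * H1 * R0 <= 1 & H1 * eta ^+ 2 <= 1].
Proof.
move=> H0_ge0 H1_ge0 R0_ge0 lambda_gt0 eta_gt0.
set M := Num.max _ _; set den := H0 + M * lambda => eta_le.
have M_sqrt : Num.sqrt H1 <= M by rewrite le_max lexx.
have M_R0 : H1 * R0 <= M by rewrite le_max lexx orbT.
have M_ge0 : 0 <= M := le_trans (sqrtr_ge0 _) M_sqrt.
have den_ge0 : 0 <= den by rewrite addr_ge0// mulr_ge0// ltW.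
(* If [den] is zero then [lambda / den] is zero as well, against [0 < eta]. *)
have den_gt0 : 0 < den.
  rewrite lt0r den_ge0 andbT; apply/eqP => den0.
  by move: eta_le; rewrite den0 invr0 mulr0 leNgt eta_gt0.
have eta_den : eta * den <= lambda by rewrite -ler_pdivlMr.
have H0_den : eta * H0 <= eta * den.
  by rewrite ler_pM2l// lerDl mulr_ge0// ltW.
have M_den : eta * (M * lambda) <= eta * den by rewrite ler_pM2l// lerDr.
have eta_M : eta * M <= 1 by rewrite -(ler_pM2r lambda_gt0); lra.
split; first exact: le_trans eta_den.
  by rewrite -mulrA; apply: le_trans eta_M; rewrite ler_pM2l.
rewrite -[H1](sqr_sqrtr H1_ge0) -exprMn mulrC expr_le1//.
  by apply: le_trans eta_M; rewrite ler_pM2l.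
by rewrite mulr_ge0 ?sqrtr_ge0// ltW.
Qed.

Theorem theoremC10 (R : realType) (d : nat)
  (dT : measure_display) (T : measurableType dT) (D : probability T R)
  (f : T -> 'rV[R]_d -> R) (F : 'rV[R]_d -> R)
  (f_int : forall x, D.-integrable setT (fun t => (f t x)%:E))
  (F_def : forall x, ('E_D[fun t => f t x] = (F x)%:E)%E)
  (f_diff : forall t x, differentiable (f t) x)
  (F_diff : forall x, differentiable F x)
  (xs : 'rV[R]_d) (xs_min : forall y, F xs <= F y)
  (H0 H1 : R) (H0_ge0 : 0 <= H0) (H1_ge0 : 0 <= H1)
  (f_smooth : {ae D, forall t, H0H1_smooth H0 H1 (f t)})
  (f_convex : {ae D, forall t, grad_convex (f t)})
  (f_unbiased : unbiased D f F)
  (rho : R) (rho_ge1 : 1 <= rho)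
  (f_sgc : strong_growth D f F rho)
  (dO : measure_display) (Omega : measurableType dO) (P : probability Omega R)
  (B : nat) (B_ge1 : (1 <= B)%N) (B_ge : 64 * (rho - 1) <= B%:R)
  (xi : nat -> 'I_B -> {RV P >-> T}) (xi_iid : iid_samples D xi)
  (x0 : 'rV[R]_d) (lambda eta : R) (lambda_gt0 : 0 < lambda)
  (eta_gt0 : 0 < eta)
  (eta_le : eta <= lambda /
     (H0 + Num.max (Num.sqrt H1) (H1 * norm2 (x0 - xs)) * lambda))
  (N : nat) :
  let R0 := norm2 (x0 - xs) in
  let F0 := F x0 - F xs in
  ('E_P[fun w => F (nsgd f eta lambda x0 (fun k i => xi k i w) N)] - (F xs)%:E
   <= (Num.max 0 (1 - eta / (4 * R0)) ^+ N * F0 + 6 * lambda * R0)%:E)%E.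
Proof.
cbv zeta; set R0 := norm2 (x0 - xs); set F0 := F x0 - F xs.
have R0_ge0 : 0 <= R0 := norm2_ge0 _.
have F0_ge0 : 0 <= F0 by rewrite subr_ge0.
have [eta_H0 eta_R0 eta_H1] :=
  nsgd_step_constants H0_ge0 H1_ge0 R0_ge0 lambda_gt0 eta_gt0 eta_le.
have [good [good_m good1] good_model] := good_samples f_int f_diff F_diff xs_min
  H0_ge0 H1_ge0 f_smooth f_convex f_sgc.
have F_model := population_model f_int F_def f_diff F_diff xs_min
  H0_ge0 H1_ge0 f_smooth f_convex f_unbiased f_sgc.
have mf := measurable_sample f_int.
have [xi_law xi_indep] := xi_iid.
suff [a [/= int_a mean_a] a_le] : exists2 a,
    has_mean P (fun w => F (nsgd f eta lambda x0 (fun k i => xi k i w) N) - F xs) a &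
    a <= Num.max 0 (1 - eta / (4 * R0)) ^+ N * F0 + 6 * lambda * R0.
  have [_] := has_meanD (conj int_a mean_a) (has_mean_cst P (F xs)).
  rewrite unlock; under eq_integral do rewrite subrK.
  by move=> ->; rewrite -EFinB lee_fin addrK.
have [eta_le4|R0_small] := leP eta (4 * R0).
  have R0_gt0 : 0 < R0 by move: (lt_le_trans eta_gt0 eta_le4); rewrite pmulr_rgt0.
  rewrite max_r; last by rewrite subr_ge0 ler_pdivrMr ?mulr_gt0// mul1r.
  exact: (nsgd_gap_rate mf f_diff F_diff F_model
    (noise_second_moment f_int f_diff f_unbiased f_sgc) lambda_gt0 B_ge1 B_ge
    xi_law xi_indep H0_ge0 H1_ge0 eta_gt0 eta_H0 eta_R0 eta_H1 (lexx _)
    good_m good1 good_model).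
have [a ha a_le] := nsgd_gap_large_step mf f_diff F_diff F_model lambda_gt0
  B_ge1 xi_law H0_ge0 H1_ge0 eta_gt0 eta_H0 eta_R0 eta_H1 (lexx _)
  good_m good1 good_model N (grad_min F_diff xs_min) R0_small.
exists a => //; apply: (le_trans a_le).
have lR : 0 <= lambda * R0 by rewrite mulr_ge0// ltW.
have : 0 <= Num.max 0 (1 - eta / (4 * R0)) ^+ N * F0.
  by rewrite mulr_ge0// exprn_ge0// le_max lexx.
by lra.
Qed.
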